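(* Conjecture 1 implies the $abc$ conjecture (both stated in the context).
   Context: $\mathbb{N}$ denotes the positive integers and $\log$ the natural logarithm. For $n\in\mathbb{N}$, $\omega(n)$ is the number of distinct prime divisors of $n$ and $\gamma(n):=\prod_{p\mid n}p$ is the product of the distinct primes dividing $n$ (so $\gamma(1)=1$). Define $$H(n):=\frac{\gamma(n)}{(\log\gamma(n))^{\omega(n)}}\qquad(n\in\mathbb{N}),$$ with the convention $0^0=1$, so that $H(1)=1$. Conjecture 1 is the statement: for every $\epsilon>0$ there exists a constant $C(\epsilon)$ such that for all $(a,b,c)\in\mathbb{N}^3$ with $\gcd(a,b,c)=1$ and $a+b=c$, one has $c<C(\epsilon)\,H(abc)^{1+\epsilon}$. The $abc$ conjecture is the statement: for every $\epsilon>0$ there exists a constant $C(\epsilon)$ such that for all $(a,b,c)\in\mathbb{N}^3$ with $\gcd(a,b,c)=1$ and $a+b=c$, one has $c<C(\epsilon)\,\gamma(abc)^{1+\epsilon}$. *)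

(* Defs.v *)
From HB Require Import structures.
From mathcomp Require Import all_boot all_order all_algebra.
From mathcomp Require Import reals exp.

Set Implicit Arguments.
Unset Strict Implicit.
Unset Printing Implicit Defensive.

Import Order.TTheory GRing.Theory Num.Theory.
Local Open Scope ring_scope.

Definition omega (n : nat) : nat := size (primes n).

Definition gamma (n : nat) : nat := (\prod_(p <- primes n) p)%N.

(* [x ^+ 0 = 1] even for [x = 0], so [H 1 = 1] as [ln 1 = 0] and [omega 1 = 0]. *)
Definition H (R : realType) (n : nat) : R :=
  (gamma n)%:R / ln ((gamma n)%:R) ^+ omega n.

Definition abc_triple (a b c : nat) : Prop :=
  [/\ (0 < a)%N, (0 < b)%N, (0 < c)%N, gcdn (gcdn a b) c = 1%N & (a + b)%N = c].

Definition conjecture1 (R : realType) : Prop :=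
  forall eps : R, 0 < eps ->
    exists C : R, forall a b c : nat, abc_triple a b c ->
      c%:R < C * H R (a * b * c) `^ (1 + eps).

Definition abc_conjecture (R : realType) : Prop :=
  forall eps : R, 0 < eps ->
    exists C : R, forall a b c : nat, abc_triple a b c ->
      c%:R < C * (gamma (a * b * c))%:R `^ (1 + eps).

(* Main.v *)
Require Import Defs.
From mathcomp Require Import all_boot all_order all_algebra.
From mathcomp Require Import reals exp.

(** The point is that [H n <= 2 * gamma n]. Since [gamma n >= 2 ^ omega n],
    one has [ln (gamma n) >= omega n * ln 2 >= omega n / 2], so
    [ln (gamma n) ^ omega n >= 1] as soon as [omega n >= 2], while for
    [omega n = 1] it is still at least [1/2]. *)

Import Order.TTheory GRing.Theory Num.Theory.
Local Open Scope ring_scope.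

Lemma expn2_omega_le_gamma (n : nat) : (2 ^ omega n <= gamma n)%N.
Proof.
(* The power of 2 becomes a product of 2s over [primes n], to be compared factor by factor. *)
rewrite /omega /gamma -count_predT -iter_muln_1 -big_const_seq.
rewrite big_seq [leqRHS]big_seq; apply: leq_prod => p.
by rewrite mem_primes => /andP[/prime_gt1].
Qed.

(** Take [ln (1 + x) <= x] at [x = -1/2] and negate. *)
Lemma ln2_ge_half (R : realType) : 2^-1 <= ln (2 : R).
Proof.
have h : (-1 : R) < - 2^-1 by rewrite ltrN2 invf_lt1 // ltr1n.
have := le_ln1Dx h.
have -> : 1 - 2^-1 = 2^-1 :> R by rewrite {1}(splitr 1) mul1r addrK.
by rewrite lnV ?posrE // lerN2.
Qed.

Lemma ln_gamma_ge (R : realType) (n : nat) :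
  (omega n)%:R / 2 <= ln ((gamma n)%:R : R).
Proof.
apply: (@le_trans _ _ (ln (2 ^+ omega n))).
  by rewrite lnXn // -[leRHS]mulr_natl ler_wpM2l // ln2_ge_half.
rewrite ler_ln ?posrE ?exprn_gt0 // -?natrX ?ler_nat ?expn2_omega_le_gamma //.
by rewrite ltr0n (leq_trans _ (expn2_omega_le_gamma n)) // expn_gt0.
Qed.

Lemma ln_gamma_exp_ge_half (R : realType) (n : nat) :
  2^-1 <= ln ((gamma n)%:R : R) ^+ omega n.
Proof.
have half_le1 : 2^-1 <= 1 :> R by rewrite invf_le1 // ler1n.
(* If [omega n = 0], the empty power is 1, although the logarithm itself vanishes. *)
have := ln_gamma_ge R n; case: (omega n) => [|[|k]] lb.
- by rewrite expr0.
- by rewrite expr1 -[leLHS]mul1r.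
- apply: (le_trans half_le1); apply: exprn_ege1; apply: le_trans lb.
  by rewrite ler_pdivlMr // mul1r ler_nat.
Qed.

(** Needed for the monotonicity of [powR], which holds on nonnegative bases. *)
Lemma H_ge0 (R : realType) (n : nat) : 0 <= H R n.
Proof.
by rewrite divr_ge0 // (le_trans _ (ln_gamma_exp_ge_half R n)) // invr_ge0.
Qed.

Lemma H_le_2gamma (R : realType) (n : nat) : H R n <= 2 * (gamma n)%:R.
Proof.
have half_gt0 : 0 < 2^-1 :> R by rewrite invr_gt0.
have lb := ln_gamma_exp_ge_half R n.
rewrite mulrC ler_wpM2l // -[leRHS]invrK lef_pV2 // posrE.
exact: lt_le_trans lb.
Qed.

Theorem proposition1 (R : realType) : conjecture1 R -> abc_conjecture R.
Proof.
move=> conj1 eps eps_gt0; have [C HC] := conj1 eps eps_gt0.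
(* The power of 2 absorbs the factor in [H_le_2gamma]; the absolute value is taken because the sign
   of [C] is unknown. *)
exists (`|C| * 2 `^ (1 + eps)) => a b c /HC /lt_le_trans; apply.
have H0 := H_ge0 R (a * b * c).
apply: (@le_trans _ _ (`|C| * H R (a * b * c) `^ (1 + eps))).
  by rewrite ler_wpM2r ?powR_ge0 // ler_norm.
rewrite -mulrA -powRM // ler_wpM2l //.
apply: ge0_ler_powR; rewrite ?nnegrE //; last exact: H_le_2gamma.
- by rewrite addr_ge0 // ltW.
- by rewrite mulr_ge0.
Qed.
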